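(* Let $S$ be a right modular groupoid with left identity element $l$. Then: (1) $S$ is ${}'$-unary, where ${}'$ is the unary operation $x\mapsto x'=xl$; (2) for any unary operation $x\mapsto x'$ on $S$ that satisfies the identities $(x')'=x$ and $(xy)'=x'y'$, the identity $x'y=y'x$ holds if and only if the identity $(xy)'=yx$ holds; (3) the only unary operation $x\mapsto x'$ on $S$ that satisfies the identities $(x')'=x$, $(xy)'=x'y'$ and $x'y=y'x$ is $x'=xl$; (4) if $\Psi:S\to S$ is an automorphism satisfying $\Psi(x)\,y=\Psi(y)\,x$ for all $x,y\in S$, then $\Psi(x)=xl$ for all $x\in S$.
   Context: A groupoid is a set with a binary operation, written as juxtaposition. A groupoid is right modular if $(xy)z=(zy)x$ for all $x,y,z$. A left identity is an element $l$ with $lx=x$ for all $x$. Given a unary operation ${}'$ on $S$, the groupoid $S$ is called ${}'$-unary if $(x')'=x$, $(xy)'=x'y'$ and $x'y=y'x$ for all $x,y\in S$. *)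

(* Defs.v *)
From mathcomp Require Import all_boot monoid.

Set Implicit Arguments.
Unset Strict Implicit.
Unset Printing Implicit Defensive.

Local Open Scope group_scope.

Definition right_modular (S : magmaType) : Prop :=
  forall x y z : S, (x * y) * z = (z * y) * x.

(* The groupoid S is '-unary, where ' is the unary operation f. *)
Definition unary_groupoid (S : magmaType) (f : S -> S) : Prop :=
  [/\ forall x, f (f x) = x,
      forall x y, f (x * y) = f x * f y
    & forall x y, f x * y = f y * x].

Definition automorphism (S : magmaType) (f : S -> S) : Prop :=
  bijective f /\ {morph f : x y / x * y}.

(* Main.v *)
Require Import Defs.
From mathcomp Require Import all_boot monoid.

Local Open Scope group_scope.

(** Right modularity with [l] in an outer slot gives [(x * y) * l = y * x]; with [l] in the middle
    it swaps [x] and [y] in [(x * l) * y]. So right multiplication by [l] is an involution reversing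
    products. Conversely, if a surjective morphism [f] satisfies the swap law, then [f l] is a left
    identity, whence [f x = (f x * l) * l = (f l * x) * l = x * l]. Uniqueness for unary operations
    and for automorphisms both follow from [surj_morph_swap_mulr_lid]. *)

Section RightModularLeftIdentity.

Variables (S : magmaType) (l : S).
Hypotheses (hS : right_modular S) (hl : forall x : S, l * x = x).

Lemma mulr_lidK (x : S) : x * l * l = x.
Proof. by rewrite hS !hl. Qed.

Lemma mul_mulr_lid (x y : S) : x * y * l = y * x.
Proof. by rewrite hS hl. Qed.

Lemma unary_mulr_lid : unary_groupoid (fun x : S => x * l).
Proof.
split=> [x|x y|x y]; first exact: mulr_lidK.
  (* Both sides reduce to [y * x]. *)
  by rewrite mul_mulr_lid [RHS]hS mulr_lidK.
exact: hS.
Qed.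

(* Surjectivity makes f l a left identity, so f y * l = f l * y = y. *)
Lemma surj_morph_swap_mulr_lid (f g : S -> S) :
  cancel g f -> {morph f : x y / x * y} ->
  (forall x y, f x * y = f y * x) -> forall x, f x = x * l.
Proof.
move=> gK fM fC x; have fl y : f l * y = y by rewrite -(gK y) -fM hl.
by rewrite -[LHS]mulr_lidK fC fl.
Qed.

End RightModularLeftIdentity.

Theorem proposition40 (S : magmaType) (l : S)
    (hS : right_modular S) (hl : forall x : S, l * x = x) :
  [/\ unary_groupoid (fun x : S => x * l),
      forall f : S -> S,
        (forall x, f (f x) = x) -> (forall x y, f (x * y) = f x * f y) ->
        ((forall x y, f x * y = f y * x) <-> (forall x y, f (x * y) = y * x)),
      forall f : S -> S,
        unary_groupoid f <-> (forall x, f x = x * l)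
    & forall Psi : S -> S,
        automorphism Psi -> (forall x y, Psi x * y = Psi y * x) ->
        forall x, Psi x = x * l].
Proof.
split.
- exact: unary_mulr_lid.
- move=> f fK fM; split=> [fC x y|fE x y].
    (* An involution is surjective, being its own inverse: [fK] serves as the cancellation
       hypothesis. *)
    by rewrite (surj_morph_swap_mulr_lid _ _ hS hl _ _ fK fM fC) mul_mulr_lid.
  (* The reversal law at the product [l * z] already determines [f]. *)
  have fl z : f z = z * l by rewrite -fE hl.
  by rewrite !fl hS.
- move=> f; split=> [[fK fM fC]|fE].
    exact: (surj_morph_swap_mulr_lid _ _ hS hl _ _ fK fM fC).
  have [iK iM iC] := unary_mulr_lid _ _ hS hl.
  by split=> [x|x y|x y]; rewrite !fE.
- move=> f [[g _ gK] fM] fC.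
  exact: (surj_morph_swap_mulr_lid _ _ hS hl _ _ gK fM fC).
Qed.
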